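(* Let $n,k,r$ be positive integers with $n\ge k(r+1)$. Suppose that $\mathcal G\subset\mathcal A(n,k)$ and $\nu(\mathcal G)\le r$. Then $$|\mathcal G|\le kr .$$
   Context: Fix a permutation $(x_1,\dots,x_n)$ of $[n]=\{1,\dots,n\}$, viewed cyclically (indices modulo $n$). For $1\le k<n$ and $1\le r\le n$ the arc $A_k(r)$ is the $k$-set $\{x_r,x_{r+1},\dots,x_{r+k-1}\}$, and $\mathcal A(n,k)=\{A_k(r):1\le r\le n\}$ is the family of all $n$ arcs of length $k$. For a family $\mathcal F$ of nonempty sets, the matching number $\nu(\mathcal F)$ is the maximum number of pairwise disjoint members of $\mathcal F$. *)

(* Defs.v *)
From mathcomp Require Import all_boot all_fingroup.

Set Implicit Arguments.
Unset Strict Implicit.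
Unset Printing Implicit Defensive.

(* The ground set [n] is 'I_n, and positions are also elements of 'I_n, with
   cyclic successor ordS; arc x k s = {x_s, x_(s+1), ..., x_(s+k-1)}. *)
Definition arc (n : nat) (x : {perm 'I_n}) (k : nat) (s : 'I_n) : {set 'I_n} :=
  [set x (iter j (@ordS n) s) | j : 'I_k].

Definition arcs (n : nat) (x : {perm 'I_n}) (k : nat) : {set {set 'I_n}} :=
  [set arc x k s | s : 'I_n].

Definition matching_number (T : finType) (F : {set {set T}}) : nat :=
  \max_(M : {set {set T}} | (M \subset F) && trivIset M) #|M|.

(* Main.v *)
Require Import Defs.
From mathcomp Require Import all_boot all_fingroup zify.

Set Implicit Arguments.
Unset Strict Implicit.
Unset Printing Implicit Defensive.

(** Identify an arc with its starting position in the cycle of length [n]: two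
    arcs of length [k] are disjoint as soon as their starts are at distance at
    least [k] in both directions around the cycle.  It must be shown that a
    set [S] of more than [k * r] starts contains [r + 1] such starts.

    If [n = k * (r + 1)], the residues modulo [k] cut the cycle into [k]
    classes of [r + 1] positions, any two of them at distance at least [k];
    fewer than [k] positions lie outside [S], so some class lies inside [S].

    A larger [n] reduces to this one by deleting positions from the cycle,
    sparing those of [S] when possible, until a set [T] of [k * (r + 1)]
    positions is left ([exists_card_mostly_in]).  Deleting positions can only
    shorten distances, so the residue classes of the *ranks* in [T] still
    consist of positions at distance at least [k] in the original cycle, and
    the same pigeonhole applies to them ([spread_positions]). *)

(** The set [T] is filled with elements of [S] before any others are used,
    which keeps the number of elements of [T] outside [S] minimal. *)
Lemma exists_card_mostly_in (I : finType) (S : {set I}) (m : nat) :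
  m <= #|I| -> exists2 T : {set I}, #|T| = m & #|T :\: S| <= m - #|S|.
Proof.
move=> le_m; pose s := enum S ++ enum (~: S).
have uniq_s : uniq s.
  rewrite cat_uniq !enum_uniq andbT /=; apply/hasPn => i.
  by rewrite !mem_enum inE.
have size_s : size s = #|I| by rewrite size_cat -!cardE cardsC.
exists [set i in take m s].
  rewrite cardsE (card_uniqP _) ?take_uniq // size_takel //.
  by rewrite size_s.
rewrite take_cat -cardE; case: ltnP => [_|_].
  suff -> : [set i in take m (enum S)] :\: S = set0 by rewrite cards0.
  apply/setP=> i; rewrite !inE; apply/negP => /andP[/negP iS /mem_take].
  by rewrite mem_enum.
apply: leq_trans (_ : size (take (m - #|S|) (enum (~: S))) <= _); last first.
  by rewrite size_take_min geq_minl.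
apply: leq_trans (card_size _); apply: subset_leq_card; apply/subsetP=> i.
by rewrite !inE mem_cat mem_enum; case: (i \in S).
Qed.

Lemma sorted_ltn_gap (s : seq nat) (i j : nat) :
  sorted ltn s -> i <= j < size s -> nth 0 s i + (j - i) <= nth 0 s j.
Proof.
move=> sorted_s /andP[le_ij]; rewrite -(subnKC le_ij) addKn.
elim: (j - i) => [|d IHd] lt_s; first by rewrite !addn0.
have /IHd le_d : i + d < size s by lia.
have : nth 0 s (i + d) < nth 0 s (i + d.+1).
  by apply: (sorted_ltn_nth ltn_trans); rewrite ?inE //; lia.
by lia.
Qed.

Lemma sorted_enum_ord (n : nat) (T : {set 'I_n}) :
  sorted ltn (map val (enum T)).
Proof.
rewrite sorted_map {1}/enum_mem -enumT.
apply: sorted_filter; first by move=> a b c; apply: ltn_trans.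
by rewrite -sorted_map val_enum_ord iota_ltn_sorted.
Qed.

(** The starts [f 0, ..., f r] have, in the increasing enumeration of a set
    [T] of [k * (r + 1)] positions, ranks [c], [c + k], ..., [c + r * k] for
    some [c < k].  If no [c] worked, each of these [k] disjoint classes of
    ranks would contain an element of [T] outside [S], but there are fewer
    than [k] such elements. *)
Lemma spread_positions (n k r : nat) (S : {set 'I_n}) :
  0 < k -> k * r.+1 <= n -> k * r < #|S| ->
  exists2 f : 'I_r.+1 -> 'I_n, forall i, f i \in S &
    forall i j : 'I_r.+1, i < j -> f i + k <= f j <= f i + (n - k).
Proof.
move=> k_gt0 le_n lt_S.
have [|T cardT cardTS] := @exists_card_mostly_in _ S (k * r.+1).
  by rewrite card_ord.
have x0 : 'I_n by apply: (@Ordinal n 0); nia.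
pose rank (c : 'I_k) (i : 'I_r.+1) := c + i * k.
pose t (c : 'I_k) (i : 'I_r.+1) := nth x0 (enum T) (rank c i).
have size_T : size (enum T) = k * r.+1 by rewrite -cardE.
have rank_lt c i : rank c i < size (enum T).
  by rewrite size_T /rank; have := ltn_ord c; have := ltn_ord i; nia.
have [c /forallP cS | noc] := pickP [pred c | [forall i, t c i \in S]].
  exists (t c) => // i j lt_ij.
  have val_t l : t c l = nth 0 (map val (enum T)) (rank c l) :> nat.
    by rewrite (nth_map x0).
  have gap a b : a <= b < k * r.+1 ->
      nth 0 (map val (enum T)) a + (b - a) <= nth 0 (map val (enum T)) b.
    move=> lt_ab; apply: sorted_ltn_gap; first exact: sorted_enum_ord.
    by rewrite size_map size_T.
  have := rank_lt c i; have := rank_lt c j; rewrite size_T => lt_j lt_i.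
  have rank_ij : rank c i + k <= rank c j <= rank c i + k * r.
    by have := ltn_ord j; rewrite /rank; nia.
  have le_ij : t c i + (rank c j - rank c i) <= t c j.
    by rewrite !val_t; apply: gap; lia.
  (* The distance the other way round goes through the first and the last
     position of [T]: the element of rank [a] is at least [a] positions away
     from [0], and at least [k * r.+1 - 1 - a] positions away from [n - 1]. *)
  have ge_i : rank c i <= t c i.
    by rewrite val_t; have := gap 0 (rank c i); lia.
  have le_j : t c j + (k * r.+1 - rank c j) <= n.
    have last_lt : nth 0 (map val (enum T)) (k * r.+1).-1 < n.
      by rewrite (nth_map x0) ?ltn_ord // size_T; lia.
    by rewrite val_t; have := gap (rank c j) (k * r.+1).-1; lia.
  by apply/andP; split; nia.
have /fin_all_exists [g gS] c : exists i, t c i \notin S.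
  by have /= /forallPn := negbT (noc c).
have inj_g : injective (fun c => t c (g c)).
  move=> c d /eqP; rewrite nth_uniq ?enum_uniq // /rank => /eqP eq_cd.
  apply: val_inj; have /(congr1 (modn^~ k)) := eq_cd.
  by rewrite ![_ + _ * k]addnC !modnMDl !modn_small.
have : #|[set t c (g c) | c : 'I_k]| <= #|T :\: S|.
  apply: subset_leq_card; apply/subsetP => _ /imsetP[c _ ->].
  by rewrite inE gS -mem_enum mem_nth.
by rewrite card_imset // card_ord; nia.
Qed.

Lemma val_iter_ordS (n j : nat) (s : 'I_n) :
  iter j (@ordS n) s = (s + j) %% n :> nat.
Proof.
elim: j => [|j IHj] /=; first by rewrite addn0 modn_small.
by rewrite IHj addnS -addn1 modnDml addn1.
Qed.

Lemma arc_disjoint (n : nat) (x : {perm 'I_n}) (k : nat) (s t : 'I_n) :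
  s + k <= t <= s + (n - k) -> [disjoint Defs.arc x k s & Defs.arc x k t].
Proof.
move=> st; rewrite -setI_eq0; apply/eqP/setP => y; rewrite !inE.
apply/negP => /andP[/imsetP[a _ ->] /imsetP[b _ /perm_inj/(congr1 val)]] /=.
rewrite !val_iter_ordS => /esym/eqP.
(* A common point makes [n] divide [t + b - (s + a)], which the two distance
   bounds place strictly between [0] and [n]. *)
have := ltn_ord a; have := ltn_ord b; have := ltn_ord t => lt_t lt_b lt_a.
rewrite eqn_mod_dvd; last by lia.
by move=> /dvdn_leq; lia.
Qed.

Lemma card_le_matching_number (T : finType) (F M : {set {set T}}) :
  M \subset F -> trivIset M -> #|M| <= matching_number F.
Proof.
move=> MF trivM; rewrite /matching_number.
by apply: (leq_bigmax_cond (F := fun M : {set {set T}} => #|M|)); rewrite MF.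
Qed.

(** Members of a family indexed by an ordered type need only be compared in
    one order; since they are nonempty, disjointness makes them distinct. *)
Lemma matching_number_family (T : finType) (F : {set {set T}}) (m : nat)
    (A : 'I_m -> {set T}) :
  (forall i, A i \in F) -> (forall i, A i != set0) ->
  (forall i j : 'I_m, i < j -> [disjoint A i & A j]) ->
  m <= matching_number F.
Proof.
move=> AF A0 disjA.
have disj (i j : 'I_m) : i != j -> [disjoint A i & A j].
  by rewrite neq_ltn => /orP[/disjA|/disjA] //; rewrite disjoint_sym.
have injA : injective A.
  move=> i j eqA; apply/eqP; apply: contraT => /disj.
  by rewrite eqA -setI_eq0 setIid (negPf (A0 j)).
rewrite -[m in m <= _]card_ord -(card_imset _ injA).
apply: card_le_matching_number.
  by apply/subsetP => _ /imsetP[i _ ->].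
apply/trivIsetP => _ _ /imsetP[i _ ->] /imsetP[j _ ->] neqA.
by apply: disj; apply: contraNneq neqA => ->.
Qed.

Theorem theorem9p3 (n k r : nat) (x : {perm 'I_n}) (G : {set {set 'I_n}}) :
  0 < n -> 0 < k -> 0 < r -> k * (r + 1) <= n ->
  G \subset arcs x k ->
  matching_number G <= r ->
  #|G| <= k * r.
Proof.
move=> _ k_gt0 _; rewrite addn1 => le_n subG; rewrite leqNgt.
apply: contraTT; rewrite negbK -ltnNge => lt_G.
pose S := [set s | Defs.arc x k s \in G].
have le_GS : #|G| <= #|S|.
  apply: leq_trans (leq_imset_card (Defs.arc x k) S); apply: subset_leq_card.
  apply/subsetP => A AG; have /imsetP[s _ eqA] := subsetP subG _ AG.
  by rewrite eqA; apply: imset_f; rewrite inE -eqA.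
have [f fS gap_f] := spread_positions k_gt0 le_n (leq_trans lt_G le_GS).
apply: (matching_number_family (A := fun i => Defs.arc x k (f i))) => [i|i|i j].
- by have := fS i; rewrite inE.
- by apply/set0Pn; exists (x (f i)); apply/imsetP; exists (Ordinal k_gt0).
- by move=> /gap_f; apply: arc_disjoint.
Qed.
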